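(* Let $E$ be a finite set, $f:2^E\to\mathbb{R}$ a polymatroid function, $g(U):=f(E)-f(E\setminus U)$ for $U\subseteq E$, and $s\in\mathbb{R}^E_{>0}$. Let $$\alpha:=\min\{h>0: s\in hP_f\},\qquad \beta:=\max\{h>0: s\in hQ_g\},$$ where this minimum and this maximum are assumed to exist. Then, for every $h>0$: (i) $s\in hP_f$ if and only if $h\ge\alpha$; (ii) $s\in hQ_g$ if and only if $h\le\beta$; (iii) $\alpha\ge\beta$, and $s\in hB_f$ if and only if $h=\alpha=\beta$.
   Context: For $x\in\mathbb{R}^E$ and $A\subseteq E$ write $x(A)=\sum_{e\in A}x(e)$. A polymatroid function is a function $f:2^E\to\mathbb{R}$ with $f(\emptyset)=0$, $f(A)\le f(B)$ whenever $A\subseteq B\subseteq E$, and $f(A\cap B)+f(A\cup B)\le f(A)+f(B)$ for all $A,B\subseteq E$. Define $$P_f=\{x\in\mathbb{R}^E: x\ge 0,\ x(A)\le f(A)\ \forall A\subseteq E\},\qquad B_f=\{x\in P_f: x(E)=f(E)\},$$ $$Q_g=\{x\in\mathbb{R}^E: x\ge 0,\ x(A)\ge g(A)\ \forall A\subseteq E\}.$$ For a set $K\subseteq\mathbb{R}^E$ and $h>0$, $hK=\{hx:x\in K\}$. *)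

(* Defs.v *)
From HB Require Import structures.
From mathcomp Require Import all_boot all_order all_algebra.
From mathcomp Require Import all_classical reals.

Set Implicit Arguments.
Unset Strict Implicit.
Unset Printing Implicit Defensive.

Import Order.TTheory GRing.Theory Num.Theory.

Local Open Scope classical_set_scope.
Local Open Scope ring_scope.

Section Polymatroid.
Variables (R : realType) (E : finType).

Implicit Types (x : {ffun E -> R}) (A B : {set E}) (f g : {set E} -> R).

Definition mass x A : R := \sum_(e in A) x e.

Record polymatroid_function f : Prop := PolymatroidFunction {
  polymatroid0 : f finset.set0 = 0;
  polymatroid_mono : forall A B, A \subset B -> f A <= f B;
  polymatroid_submod : forall A B, f (A :&: B) + f (A :|: B) <= f A + f B
}.

Definition Ppoly f : set {ffun E -> R} :=
  [set x : {ffun E -> R} | (forall e, 0 <= x e) /\ (forall A, mass x A <= f A)].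

Definition Bpoly f : set {ffun E -> R} :=
  [set x : {ffun E -> R} | Ppoly f x /\ mass x [set: E]%SET = f [set: E]%SET].

Definition Qpoly g : set {ffun E -> R} :=
  [set x : {ffun E -> R} | (forall e, 0 <= x e) /\ (forall A, g A <= mass x A)].

Definition dilate (h : R) (K : set {ffun E -> R}) : set {ffun E -> R} :=
  [set [ffun e => h * x e] | x in K].

End Polymatroid.

Definition is_min (R : realType) (S : set R) (m : R) : Prop := S m /\ lbound S m.
Definition is_max (R : realType) (S : set R) (m : R) : Prop := S m /\ ubound S m.

(* Main.v *)
Require Import Defs.
From HB Require Import structures.
From mathcomp Require Import all_boot all_order all_algebra.
From mathcomp Require Import all_classical reals.

(** For h > 0 and s >= 0, dividing by h turns membership of s in a dilated
polyhedron into the linear inequalities s(A) <= h f(A), respectively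
h g(A) <= s(A), for all A.  As f and g are nonnegative (both because f is
monotone), the first family is upward closed in h and the second downward
closed, so an attained minimum or maximum determines all admissible h.

The comparison of alpha and beta uses A = E only: since g(E) = f(E),
beta f(E) <= s(E) <= alpha f(E), and f(E) > 0, because f(E) = 0 would make
g <= 0 and leave beta without an upper bound.  Finally the base polytope is the
intersection of the two polyhedra, B_f = P_f `&` Q_g, by complementation, a
fact that passes to dilations; so s lies in h B_f exactly when
alpha <= h <= beta. *)

Set Implicit Arguments.
Unset Strict Implicit.
Unset Printing Implicit Defensive.

Import Order.TTheory GRing.Theory Num.Theory.

Local Open Scope classical_set_scope.
Local Open Scope ring_scope.

Section Dilation.
Variables (R : realType) (E : finType).
Implicit Types (s x : {ffun E -> R}) (f g : {set E} -> R) (h : R).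

Lemma mass_scale h x (A : {set E}) :
  mass [ffun e => h * x e] A = h * mass x A.
Proof. by rewrite /mass mulr_sumr; apply: eq_bigr => e _; rewrite ffunE. Qed.

Lemma mass_compl x (A : {set E}) :
  mass x [set: E]%SET = mass x A + mass x (~: A).
Proof.
rewrite /mass (bigID (mem A)) /=.
by congr (_ + _); apply: eq_bigl => e; rewrite !finset.inE.
Qed.

Lemma dilateE h (K : set {ffun E -> R}) s :
  0 < h -> dilate h K s <-> K [ffun e => h^-1 * s e].
Proof.
move=> h_gt0; have h_neq0 := lt0r_neq0 h_gt0; split=> [[x Kx <-]|Ks].
  have -> // : [ffun e => h^-1 * [ffun e => h * x e] e] = x.
  by apply/ffunP => e; rewrite !ffunE mulKf.
exists [ffun e => h^-1 * s e] => //.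
by apply/ffunP => e; rewrite !ffunE mulVKf.
Qed.

Lemma dilate_PpolyE h f s : 0 < h -> (forall e, 0 <= s e) ->
  dilate h (Ppoly f) s <-> forall A, mass s A <= h * f A.
Proof.
move=> h_gt0 s_ge0; apply: iff_trans (dilateE _ _ h_gt0) _; split.
  by case=> _ sf A; rewrite -ler_pdivrMl // -mass_scale.
move=> sf; split=> [e|A]; last by rewrite mass_scale ler_pdivrMl.
by rewrite ffunE mulr_ge0 // invr_ge0 ltW.
Qed.

Lemma dilate_QpolyE h g s : 0 < h -> (forall e, 0 <= s e) ->
  dilate h (Qpoly g) s <-> forall A, h * g A <= mass s A.
Proof.
move=> h_gt0 s_ge0; apply: iff_trans (dilateE _ _ h_gt0) _; split.
  by case=> _ gs A; rewrite -ler_pdivlMl // -mass_scale.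
move=> gs; split=> [e|A]; last by rewrite mass_scale ler_pdivlMl.
by rewrite ffunE mulr_ge0 // invr_ge0 ltW.
Qed.

(** On the hyperplane x(E) = f(E), the bound x(A) <= f(A) is equivalent to
x(E \ A) >= g(E \ A); conversely, the bounds of P_f and Q_g at E force
x onto that hyperplane, as g(E) = f(E). *)
Lemma BpolyE f g : f finset.set0 = 0 ->
  (forall U : {set E}, g U = f [set: E]%SET - f (~: U)) ->
  Bpoly f = Ppoly f `&` Qpoly g.
Proof.
move=> f0 gE; apply/seteqP; split=> x.
  move=> [[x_ge0 xf] xE]; do 2!split=> //.
  by move=> A; rewrite gE -xE (mass_compl x A) lerBlDr lerD2l.
move=> [xP [_ gx]]; split=> //; apply: le_anti; apply/andP; split.
  by have [_] := xP; apply.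
by have := gx [set: E]%SET; rewrite gE finset.setCT f0 subr0.
Qed.

Lemma dilateI h (K L : set {ffun E -> R}) s : 0 < h ->
  dilate h (K `&` L) s <-> dilate h K s /\ dilate h L s.
Proof.
move=> h_gt0; have dE M := dilateE M s h_gt0.
by split=> [/dE[/dE ? /dE]|[/dE Ks /dE Ls]] //; apply/dE.
Qed.

End Dilation.

Theorem theorem3p19 (R : realType) (E : finType) (f g : {set E} -> R)
    (s : {ffun E -> R}) (alpha beta : R)
    (f_polymatroid : polymatroid_function f)
    (gE : forall U : {set E}, g U = f [set: E]%SET - f (~: U))
    (s_gt0 : forall e, 0 < s e)
    (alpha_min : is_min [set h : R | 0 < h /\ dilate h (Ppoly f) s] alpha)
    (beta_max : is_max [set h : R | 0 < h /\ dilate h (Qpoly g) s] beta) :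
  forall h : R, 0 < h ->
    [/\ dilate h (Ppoly f) s <-> alpha <= h,
        dilate h (Qpoly g) s <-> h <= beta &
        beta <= alpha /\
        (dilate h (Bpoly f) s <-> h = alpha /\ alpha = beta)].
Proof.
move=> h h_gt0.
have [[alpha_gt0 sP_alpha] alpha_lb] := alpha_min.
have [[beta_gt0 sQ_beta] beta_ub] := beta_max.
have [f0 f_mono _] := f_polymatroid.
have s_ge0 e : 0 <= s e := ltW (s_gt0 e).
have f_ge0 A : 0 <= f A by rewrite -f0 f_mono ?finset.sub0set.
have g_ge0 A : 0 <= g A by rewrite gE subr_ge0 f_mono ?finset.subsetT.
have sf_alpha := (dilate_PpolyE f alpha_gt0 s_ge0).1 sP_alpha.
have gs_beta := (dilate_QpolyE g beta_gt0 s_ge0).1 sQ_beta.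
have sPE : dilate h (Ppoly f) s <-> alpha <= h.
  split=> [sP|le_alpha_h]; first exact: alpha_lb.
  apply/dilate_PpolyE => // A.
  by apply: le_trans (sf_alpha A) _; rewrite ler_wpM2r.
have sQE : dilate h (Qpoly g) s <-> h <= beta.
  split=> [sQ|le_h_beta]; first exact: beta_ub.
  apply/dilate_QpolyE => // A.
  by apply: le_trans (gs_beta A); rewrite ler_wpM2r.
have fE_gt0 : 0 < f [set: E]%SET.
  rewrite lt_def f_ge0 andbT; apply/eqP => fE0.
  have beta1_gt0 : 0 < beta + 1 by rewrite addr_gt0.
  have : beta + 1 <= beta.
    apply: beta_ub; split=> //; apply/dilate_QpolyE => // A.
    have -> : g A = 0.
      by apply: le_anti; rewrite g_ge0 gE fE0 sub0r oppr_le0 f_ge0.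
    by rewrite mulr0 sumr_ge0.
  by rewrite gerDl ler10.
have le_beta_alpha : beta <= alpha.
  rewrite -(ler_pM2r fE_gt0); apply: le_trans (sf_alpha _).
  by have := gs_beta [set: E]%SET; rewrite gE finset.setCT f0 subr0.
split=> //; split=> //.
rewrite (BpolyE f0 gE); apply: iff_trans (dilateI _ _ _ h_gt0) _; split.
  move=> [/sPE le_alpha_h /sQE le_h_beta].
  have alphaE : alpha = beta.
    by apply: le_anti; rewrite le_beta_alpha (le_trans le_alpha_h).
  by split=> //; apply: le_anti; rewrite le_alpha_h alphaE le_h_beta.
by move=> [h_alpha alpha_beta]; split; [apply/sPE | apply/sQE];
  rewrite h_alpha ?alpha_beta.
Qed.
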